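(* For a connected cubic graph $G$ of girth $\ell$, $$\mathbb{E}[F]=\sum_{C\in\mathcal C_{\mathrm{NB}}(G)}\chi(C)\,2^{-r(C)}, \qquad L(G)=\sum_{\substack{C\in\mathcal C_{\mathrm{NB}}(G)\\ |C|\ge 2\ell}}\chi(C)\,2^{-r(C)}.$$
   Context: All graphs are finite and simple; cubic means $3$-regular; the girth $\ell$ is the length of a shortest cycle. A dart of $G$ is an ordered pair $(u,v)$ with $uv\in E(G)$; its tail is $u$, its head is $v$, and $\alpha(u,v)=(v,u)$. A rotation system $\rho$ of $G$ assigns to each vertex $v$ a cyclic ordering of its neighbours; $\sigma_v(u)$ denotes the neighbour of $v$ following $u$. The face permutation on darts is $\phi_\rho(u,v)=(v,\sigma_v(u))$; its cycles are the faces of $\rho$, the length of a face is the length of that cycle, $F(\rho)$ is the number of faces, and $F_{\ge t}(\rho)$ the number of faces of length $\ge t$. Expectations are over $\rho$ uniformly random among all rotation systems of $G$. The expected long-face contribution is $L(G)=\mathbb{E}[F_{\ge 2\ell}]$. A circuit of length $k$ is a cyclic sequence $C=(d_0,\dots,d_{k-1})$ of pairwise distinct darts, up to cyclic shift, in which the head of $d_i$ is the tail of $d_{i+1}$ and $d_{i+1}\neq\alpha(d_i)$ (indices mod $k$); $|C|=k$. Each pass $d_i=(u,v)$, $d_{i+1}=(v,w)$ imposes the constraint $\sigma_v(u)=w$. $\mathcal C_{\mathrm{NB}}(G)$ is the (finite) set of all circuits of all lengths. Set $\chi(C)=1$ if some rotation system of $G$ meets every constraint of $C$, and $\chi(C)=0$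 otherwise; $r(C)$ is the number of distinct vertices visited by $C$. *)

(* Defs.v *)
From mathcomp Require Import all_boot all_order all_fingroup all_algebra.

Set Implicit Arguments.
Unset Strict Implicit.
Unset Printing Implicit Defensive.

Import GRing.Theory Num.Theory.

Section Graphs.

Variables (T : finType) (e : rel T).

Definition simple_graph : Prop := symmetric e /\ irreflexive e.

Definition nbhd (v : T) : {set T} := [set w | e v w].

Definition cubic : Prop := forall v, #|nbhd v| = 3.

Definition connected_graph : Prop := forall u v, connect e u v.

(* The bound on the size discards the degenerate closed walks [::] and         *)
(* [:: u; v], which satisfy ucycle but are not cycles of a simple graph.       *)
Definition graph_cycle (c : seq T) : Prop := 2 < size c /\ ucycle e c.

Definition has_girth (l : nat) : Prop :=
  (exists2 c, graph_cycle c & size c = l) /\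
  (forall c, graph_cycle c -> l <= size c).

(* A dart (u, v) has tail u and head v. *)
Definition darts : {set T * T} := [set d | e d.1 d.2].

Definition dart_rev (d : T * T) : T * T := (d.2, d.1).

End Graphs.

Section Rotations.

Variables (T : finType) (e : rel T).

(* A cyclic ordering of nbhd e v is encoded by its successor map: a            *)
(* permutation supported on nbhd e v and acting on it as a single cycle.       *)
(* Fixing the points outside nbhd e v makes the encoding one-to-one.           *)
Definition rotation_systems : {set {ffun T -> {perm T}}} :=
  [set rho : {ffun T -> {perm T}} |
    [forall v, perm_on (nbhd e v) (rho v) &&
       [forall u in nbhd e v, porbit (rho v) u == nbhd e v]]].

Definition face_fun (rho : {ffun T -> {perm T}}) (d : T * T) : T * T :=
  (d.2, rho d.2 d.1).

Lemma face_fun_inj rho : injective (face_fun rho).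
Proof. by move=> [u v] [x y] /= [<-] /perm_inj ->. Qed.

(* The face permutation is defined on all pairs; for a rotation system it      *)
(* preserves darts e, and only the orbits of darts count as faces.             *)
Definition face_perm (rho : {ffun T -> {perm T}}) : {perm T * T} :=
  perm (@face_fun_inj rho).

Definition faces (rho : {ffun T -> {perm T}}) : {set {set T * T}} :=
  [set porbit (face_perm rho) d | d in darts e].

Definition num_faces (rho : {ffun T -> {perm T}}) : nat := #|faces rho|.

Definition num_faces_ge (t : nat) (rho : {ffun T -> {perm T}}) : nat :=
  #|[set f in faces rho | t <= #|f|]|.

Local Open Scope ring_scope.

Definition rot_expect (X : {ffun T -> {perm T}} -> rat) : rat :=
  (\sum_(rho in rotation_systems) X rho) / #|rotation_systems|%:R.

Definition long_face_contribution (l : nat) : rat :=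
  rot_expect (fun rho => (num_faces_ge (2 * l)%N rho)%:R).

End Rotations.

Section Circuits.

Variables (T : finType) (e : rel T).

(* Sequences of pairwise distinct darts have length at most #|T * T|, so       *)
(* bounded sequences, which form a finType, contain all of them.               *)
Definition dart_seq : finType := #|{: T * T}|.-bseq (T * T).

(* path.cycle also tests the pair (last, first), i.e., indices are taken mod k. *)
Definition circuit_seq (s : seq (T * T)) : bool :=
  [&& s != [::], all [in darts e] s, uniq s &
      path.cycle [rel d d' | (d.2 == d'.1) && (d' != dart_rev d)] s].

Definition shift_eq (s s' : dart_seq) : bool :=
  [exists i : 'I_(size s).+1, s' == rot i s :> seq _].

(* A circuit is a class of sequences under cyclic shift. *)
Definition circuits : {set {set dart_seq}} :=
  equivalence_partition shift_eq [set s : dart_seq | circuit_seq s].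

Definition meets (rho : {ffun T -> {perm T}}) (s : seq (T * T)) : bool :=
  path.cycle [rel d d' | rho d.2 d.1 == d'.2] s.

Definition seq_chi (s : seq (T * T)) : bool :=
  [exists rho in rotation_systems e, meets rho s].

(* Tails suffice: each head in a circuit is the tail of the next dart. *)
Definition seq_r (s : seq (T * T)) : nat := #|[set d.1 | d in s]|.

Definition circuit_repr (C : {set dart_seq}) : seq (T * T) :=
  if [pick s in C] is Some s then val s else [::].

Definition circuit_len (C : {set dart_seq}) : nat := size (circuit_repr C).
Definition chi (C : {set dart_seq}) : bool := seq_chi (circuit_repr C).
Definition circuit_r (C : {set dart_seq}) : nat := seq_r (circuit_repr C).

(* The three quantities above do not depend on the representative. *)
Lemma shift_classP (s : dart_seq) :
  s \in [set s : dart_seq | circuit_seq s] ->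
  let C := [set s' in [set s : dart_seq | circuit_seq s] | shift_eq s s'] in
  [/\ circuit_len C = size s, chi C = seq_chi s & circuit_r C = seq_r s].
Proof.
move=> sP C.
have sC : s \in C.
  by rewrite inE sP /=; apply/existsP; exists ord0; rewrite rot0.
rewrite /circuit_len /chi /circuit_r /circuit_repr.
case: pickP => [s' | /(_ s)]; last by rewrite sC.
rewrite inE => /andP[_ /existsP[i /eqP /= ->]] /=; split; first exact: size_rot.
  by apply: eq_existsb => rho; rewrite /meets rot_cycle.
by apply: eq_card => v; apply/imsetP/imsetP => -[d]; rewrite ?mem_rot => ds ->;
  exists d; rewrite ?mem_rot.
Qed.

End Circuits.

(* Main.v *)
Require Import Defs.
From mathcomp Require Import all_boot all_order all_fingroup all_algebra.

Set Implicit Arguments.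
Unset Strict Implicit.
Unset Printing Implicit Defensive.

Import GRing.Theory Num.Theory.
Local Open Scope ring_scope.

(** Fix a rotation system.  Each of its faces, read as a cyclic sequence of darts,
    is a circuit: it does not backtrack, because the cyclic ordering at a vertex
    with three neighbours has no fixed point.  The face meets its own
    constraints.  Conversely a circuit whose constraints are all met follows the
    face permutation, so it is one of the faces.  Hence the number of faces of
    length at least [t] is the number of circuits of length at least [t] that
    the rotation system meets ([num_faces_ge_circuits]), and by linearity its
    expectation is the sum of the probabilities that the circuits are met.

    A vertex of degree three has exactly two cyclic orderings, and prescribing
    the successor of a single neighbour selects one of them
    ([card_cyclic_orderings], [cyclic_ordering_inj]).  A uniform rotation system
    makes these binary choices independently.  If the constraints of a circuit
    are consistent, they fix the choice at each visited vertex and leave the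
    others free, so they are met with probability 2^-r, where r is the number of
    visited vertices; otherwise they are never met ([mean_meets]).

    Both identities are this computation, with [t = 0] and [t = 2 * l]. *)

(** * Cyclic orderings of a three-element set *)

Definition cyclic_orderings (T : finType) (A : {set T}) : {set {perm T}} :=
  [set p | perm_on A p && [forall u in A, porbit p u == A]].

Section ThreeElements.

Variables (T : finType) (A : {set T}).
Hypothesis A3 : #|A| = 3.

Lemma cyclic_ordering_traject p u :
  p \in cyclic_orderings A -> u \in A ->
  uniq [:: u; p u; p (p u)] /\ A =i [:: u; p u; p (p u)].
Proof.
rewrite inE => /andP[_ /'forall_implyP/(_ u) pA] uA.
have := porbit_traject p u; have := uniq_traject_porbit p u.
by rewrite (eqP (pA uA)) A3.
Qed.

Lemma cyclic_ordering_cube p u :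
  p \in cyclic_orderings A -> u \in A -> p (p (p u)) = u.
Proof.
rewrite inE => /andP[_ /'forall_implyP/(_ u) pA] uA.
by have := iter_porbit p u; rewrite (eqP (pA uA)) A3.
Qed.

Lemma cyclic_ordering_neq p u :
  p \in cyclic_orderings A -> u \in A -> p u != u.
Proof.
move=> pA uA; have [] := cyclic_ordering_traject pA uA.
by rewrite /= !inE negb_or eq_sym => /andP[/andP[]].
Qed.

(** Once the successor of [u] is known, the third element must come next, so a
    single value pins down the whole ordering. *)
Lemma cyclic_ordering_inj p q u :
  p \in cyclic_orderings A -> q \in cyclic_orderings A -> u \in A ->
  p u = q u -> p = q.
Proof.
move=> pA qA uA pq.
have [pU pE] := cyclic_ordering_traject pA uA.
have [qU qE] := cyclic_ordering_traject qA uA.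
(* [q (q u)] is in [A] but is neither [u] nor [q u = p u]. *)
have pq2 : p (p u) = q (q u).
  have := pE (q (q u)); rewrite qE !inE eqxx !orbT => /esym.
  move: qU; rewrite -pq /= !inE negb_or => /and3P[/andP[_ n1] n2 _].
  by rewrite ![q (p u) == _]eq_sym (negPf n1) (negPf n2) eq_sym => /eqP.
apply/permP => x; have [xA | xA] := boolP (x \in A).
  move: xA; rewrite pE !inE => /or3P[] /eqP -> //; first by rewrite pq2 pq.
  by rewrite (cyclic_ordering_cube pA uA) pq2 (cyclic_ordering_cube qA uA).
move: pA qA; rewrite !inE => /andP[pA _] /andP[qA _].
by rewrite (out_perm pA xA) (out_perm qA xA).
Qed.

(** The two orderings of a three-element set are mutually inverse 3-cycles. *)
Lemma card_cyclic_orderings p :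
  p \in cyclic_orderings A -> #|cyclic_orderings A| = 2.
Proof.
move=> pA; have [u uA] : exists u, u \in A by apply/card_gt0P; rewrite A3.
have pVA : (p^-1)%g \in cyclic_orderings A.
  move: pA; rewrite !inE => /andP[/perm_onV-> /'forall_implyP pA] /=.
  by apply/'forall_implyP => x xA; rewrite porbitV pA.
have pV : (p^-1)%g u = p (p u).
  by apply: (@perm_inj _ p); rewrite permKV (cyclic_ordering_cube pA uA).
have [pU pE] := cyclic_ordering_traject pA uA.
suff -> : cyclic_orderings A = [set p; (p^-1)%g].
  rewrite cards2; case: eqVneq => // /permP/(_ u); rewrite pV => eqp.
  by move: pU; rewrite /= -eqp !inE eqxx andbF.
apply/setP => q; rewrite in_set2; apply/idP/orP => [qA | [] /eqP -> //].
have := pE (q u); have qAu : q u \in A.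
  by have [_ ->] := cyclic_ordering_traject qA uA; rewrite !inE eqxx orbT.
rewrite qAu !inE => /esym/or3P[] /eqP q_u.
- by have := cyclic_ordering_neq qA uA; rewrite q_u eqxx.
- by left; apply/eqP; apply: cyclic_ordering_inj q_u.
- by right; apply/eqP; apply: (cyclic_ordering_inj qA pVA uA); rewrite pV.
Qed.

End ThreeElements.

(** * The faces of a rotation system as circuits *)

Section CyclesOfPermutation.

Variables (T : finType) (p : {perm T}).

Lemma porbit_orbit x : porbit p x =i fingraph.orbit p x.
Proof.
move=> y; rewrite -fconnect_orbit.
apply/porbitP/idP => [[i ->] | /iter_findex <-].
  by rewrite permX fconnect_iter.
by exists (findex p x y); rewrite permX.
Qed.

Lemma fcycle_porbit s x :
  fcycle p s -> x \in s -> [set y in s] = porbit p x.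
Proof.
move=> ps xs; apply/setP => y.
by rewrite inE porbit_orbit -fconnect_orbit (fconnect_cycle ps xs).
Qed.

(** Such a sequence is determined by its first element, since each entry is the
    image of the one before: shift [s] to start where [s'] does. *)
Lemma fcycle_rot s s' :
  fcycle p s -> fcycle p s' -> uniq s -> uniq s' -> s =i s' ->
  exists i, s' = rot i s.
Proof.
case: s' => [|y s'] ps ps' Us Us' ss'.
  by exists 0; case: s ss' {ps Us} => // x s /(_ x); rewrite !inE eqxx.
have ys' : y \in y :: s' by rewrite mem_head.
have ys : y \in s by rewrite ss'.
exists (index y s); rewrite -(fingraph.orbitE ps Us ys).
by rewrite (fingraph.orbitE ps' Us' ys') /= eqxx rot0.
Qed.

End CyclesOfPermutation.

Section ShiftClasses.

Variables (T : finType) (e : rel T).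
Implicit Types (s : dart_seq T) (C : {set dart_seq T}).

Lemma shift_eqP s s' :
  reflect (exists i, val s' = rot i (val s)) (shift_eq s s').
Proof.
apply: (iffP existsP) => [[i /eqP s's] | [i s's]]; first by exists i.
have [le_i | lt_i] := leqP i (size s).
  by exists (Ordinal (le_i : i < (size s).+1)%N); apply/eqP.
by exists ord0; rewrite rot0; apply/eqP; rewrite -(rot_oversize (ltnW lt_i)).
Qed.

Lemma shift_eq_equiv : equivalence_rel (@shift_eq T).
Proof.
have sym s s' : shift_eq s s' -> shift_eq s' s.
  move=> /shift_eqP[i ss']; apply/shift_eqP.
  by exists (size s' - i)%N; rewrite -[LHS](rotK i) -ss'.
have trans s s' s'' : shift_eq s s' -> shift_eq s' s'' -> shift_eq s s''.
  move=> /shift_eqP[i ss'] /shift_eqP[j ss'']; apply/shift_eqP.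
  by exists (rot_add s i j); rewrite -rot_rot_add -ss'.
move=> s s' s''; split=> [|ss'].
  by apply/shift_eqP; exists 0; rewrite rot0.
by apply/idP/idP; apply: trans => //; apply: sym.
Qed.

Definition shift_class s : {set dart_seq T} :=
  [set s' in [set s' : dart_seq T | circuit_seq e s'] | shift_eq s s'].

Lemma shift_class_circuits s : circuit_seq e s -> shift_class s \in circuits e.
Proof. by move=> sP; apply: imset_f; rewrite inE. Qed.

Lemma circuit_repr_class s :
  circuit_seq e s -> exists i, circuit_repr (shift_class s) = rot i s.
Proof.
move=> sP; rewrite /circuit_repr; case: pickP => [s' | /(_ s)].
  by rewrite inE => /andP[_ /shift_eqP].
by rewrite !inE sP; case: (shift_eq_equiv s s s) => ->.
Qed.

Lemma circuits_repr C : C \in circuits e ->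
  exists s, [/\ circuit_seq e s, C = shift_class s & circuit_repr C = val s].
Proof.
case/imsetP => s; rewrite inE => sP defC.
have sC : s \in C by rewrite defC !inE sP; case: (shift_eq_equiv s s s) => ->.
rewrite /circuit_repr; case: pickP => [s' | /(_ s)]; last by rewrite sC.
rewrite {1}defC !inE => /andP[s'P ss']; exists s'; split=> //.
rewrite defC; apply/setP => s''; rewrite !inE.
by have [_ /(_ ss') ->] := shift_eq_equiv s s' s''.
Qed.

Lemma circuit_repr_inj C C' i : C \in circuits e -> C' \in circuits e ->
  circuit_repr C' = rot i (circuit_repr C) -> C = C'.
Proof.
move=> /circuits_repr[s [sP -> ->]] /circuits_repr[s' [s'P -> ->]] s's.
have ss' : shift_eq s s' by apply/shift_eqP; exists i.
apply/setP => s''; rewrite !inE.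
by have [_ /(_ ss') ->] := shift_eq_equiv s s' s''.
Qed.

End ShiftClasses.

Section Faces.

Variables (T : finType) (e : rel T).
Hypotheses (e_sym : symmetric e) (e_cubic : cubic e).
Implicit Types (rho : {ffun T -> {perm T}}) (s : seq (T * T)).

Lemma rotation_systemsE rho :
  (rho \in rotation_systems e) =
    [forall v, rho v \in cyclic_orderings (nbhd e v)].
Proof. by rewrite inE; apply: eq_forallb => v; rewrite inE. Qed.

(** The constraints prescribe the heads of the successive darts, as the face
    permutation does; their tails already match along a walk. *)
Lemma meets_fcycle rho s :
  circuit_seq e s -> meets rho s = fcycle (face_perm rho) s.
Proof.
case/and4P => _ _ _ s_nb.
have -> : fcycle (face_perm rho) s =
    path.cycle [rel d d' | (d.2 == d'.1) && (rho d.2 d.1 == d'.2)] s.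
  by apply: eq_cycle => -[u v] [x y]; rewrite /= permE.
rewrite (cycle_relI (fun d d' : T * T => d.2 == d'.1)
                    (fun d d' : T * T => rho d.2 d.1 == d'.2)).
by rewrite (sub_cycle _ s_nb) // => d d' /andP[].
Qed.

Lemma face_perm_darts rho d :
  rho \in rotation_systems e -> d \in darts e -> face_perm rho d \in darts e.
Proof.
rewrite rotation_systemsE !inE permE => /forallP/(_ d.2).
rewrite inE => /andP[rho_on _].
by have := perm_closed d.1 rho_on; rewrite !inE e_sym => ->; rewrite e_sym.
Qed.

(** Successive darts on a face never backtrack, as a cyclic ordering of three
    neighbours has no fixed point. *)
Lemma face_perm_neq_rev rho d :
  rho \in rotation_systems e -> d \in darts e ->
  face_perm rho d != dart_rev d.
Proof.
rewrite rotation_systemsE inE e_sym permE => /forallP/(_ d.2) rho_v ed.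
by rewrite xpair_eqE eqxx (cyclic_ordering_neq (e_cubic _) rho_v) ?inE.
Qed.

Lemma orbit_circuit rho d :
  rho \in rotation_systems e -> d \in darts e ->
  circuit_seq e (fingraph.orbit (face_perm rho) d).
Proof.
move=> rhoP dP; set f := face_perm rho.
have orbP : {subset fingraph.orbit f d <= darts e}.
  move=> x; rewrite -fconnect_orbit => /iter_findex <-.
  by elim: (findex f d x) => //= n; apply: face_perm_darts.
apply/and4P; split; last 1 first.
- have := cycle_orbit (@perm_inj _ f) d.
  apply: (@sub_in_cycle _ (mem (darts e))); last exact/allP.
  move=> x _ xP _ /= /eqP <-; rewrite face_perm_neq_rev // andbT.
  by rewrite permE.
- by rewrite -size_eq0 size_orbit -lt0n fingraph.order_gt0.
- exact/allP.
- exact: orbit_uniq.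
Qed.

(** Each face of [rho] traces one circuit that [rho] meets; conversely such a
    circuit is a cycle of the face permutation, hence determined, up to shift,
    by its set of darts. *)
Lemma num_faces_ge_circuits rho t :
  rho \in rotation_systems e ->
  num_faces_ge e t rho =
    #|[set C in circuits e | (t <= circuit_len C)%N
                             && meets rho (circuit_repr C)]|.
Proof.
move=> rhoP; set f := face_perm rho.
pose face (C : {set dart_seq T}) := [set d in circuit_repr C].
rewrite -(@card_in_imset _ _ face).
  apply: eq_card => F; apply/setIdP/imsetP => [[/imsetP[d dP ->] le_t] | [C]].
    have sP := orbit_circuit rhoP dP.
    have size_s : (size (fingraph.orbit f d) <= #|{: T * T}|)%N.
      by rewrite size_orbit max_card.
    pose s : dart_seq T := Bseq size_s.
    have [i Ci] := @circuit_repr_class _ e s sP.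
    have Cd : face (shift_class e s) = porbit f d.
      by apply/setP => x; rewrite inE Ci mem_rot porbit_orbit.
    exists (shift_class e s) => //.
    rewrite inE shift_class_circuits //= /circuit_len Ci size_rot /=.
    rewrite /meets rot_cycle -[path.cycle _ _]/(meets rho (val s)).
    rewrite meets_fcycle // cycle_orbit ?andbT; last exact: perm_inj.
    by rewrite -(card_uniqP (orbit_uniq f d)) -(eq_card (porbit_orbit f d)).
  rewrite inE => /and3P[/circuits_repr[s [sP _ Cs]] le_t Cf] ->.
  rewrite /face /circuit_len Cs in le_t Cf *; rewrite meets_fcycle // in Cf.
  case/and4P: (sP) => s_n0 /allP s_darts s_uniq _.
  have [d ds] : exists d, d \in bseqval s.
    by case: (bseqval s) s_n0 => [|d ?] // _; exists d; rewrite mem_head.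
  split; last by rewrite cardsE (card_uniqP s_uniq).
  by rewrite (fcycle_porbit Cf ds); apply: imset_f; exact: s_darts.
move=> C C' /setIdP[CP /andP[_ Cf]] /setIdP[C'P /andP[_ C'f]] /setP CC'.
have [s [sP _ Cs]] := circuits_repr CP.
have [s' [s'P _ Cs']] := circuits_repr C'P.
rewrite Cs Cs' in Cf C'f; rewrite !meets_fcycle // in Cf C'f.
case/and4P: (sP) => _ _ Us _; case/and4P: (s'P) => _ _ Us' _.
have [|i rot_i] := fcycle_rot Cf C'f Us Us'.
  by move=> x; have := CC' x; rewrite !inE Cs Cs'.
by apply: (@circuit_repr_inj _ e _ _ i) => //; rewrite Cs Cs'.
Qed.

(** * The probability of meeting a circuit *)

(** Every visited vertex carries a constraint, which prescribes one value of the
    ordering there, and one value determines that ordering. So the rotation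
    systems meeting [s] are those agreeing with a given one at the visited
    vertices. *)
Lemma meets_agree rho rho0 s :
  circuit_seq e s -> rho0 \in rotation_systems e -> meets rho0 s ->
  rho \in rotation_systems e ->
  meets rho s = [forall v in [set d.1 | d in s], rho v == rho0 v].
Proof.
move=> sP; rewrite !rotation_systemsE => /forallP rho0P rho0s /forallP rhoP.
case/and4P: (sP) => _ /allP s_darts s_uniq s_nb.
apply/idP/forall_inP => [rhos _ /imsetP[d ds ->] | agree].
  (* The dart before [d] carries the constraint at the tail of [d]. *)
  have d'P := prev_cycle s_nb ds; have [/eqP d'd _] := andP d'P.
  have := prev_cycle rhos ds; have := prev_cycle rho0s ds.
  rewrite /= d'd => /eqP <- /eqP rho_eq; apply/eqP.
  apply: (cyclic_ordering_inj (e_cubic _) (rhoP _) (rho0P _)) rho_eq.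
  have := s_darts (prev s d); rewrite mem_prev !inE e_sym => /(_ ds).
  by rewrite d'd.
apply: cycle_from_next => // d ds /=.
have /andP[/eqP dd' _] := next_cycle s_nb ds.
have /eqP -> : rho d.2 == rho0 d.2.
  by apply: agree; rewrite dd'; apply: imset_f; rewrite mem_next.
exact: next_cycle rho0s ds.
Qed.

(** A rotation system is an independent choice of one of two cyclic orderings at
    every vertex, and the constraints fix the choice at the visited ones. *)
Lemma card_meets rho0 s :
  circuit_seq e s -> rho0 \in rotation_systems e -> meets rho0 s ->
  (#|[set rho in rotation_systems e | meets rho s]| * 2 ^ seq_r s =
    #|rotation_systems e|)%N.
Proof.
move=> sP rho0P rho0s.
pose V := [set d.1 | d in s].
pose R v := mem (cyclic_orderings (nbhd e v)).
pose R' v :=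
  mem (if v \in V then [set rho0 v] else cyclic_orderings (nbhd e v)).
have rho0v v : rho0 v \in cyclic_orderings (nbhd e v).
  by move: rho0P; rewrite rotation_systemsE => /forallP.
have cardR v : #|R v| = 2.
  by apply: (card_cyclic_orderings (e_cubic v)) (rho0v v).
have cardR' v : #|R' v| = if v \in V then 1 else 2.
  by rewrite /R'; case: (v \in V); [rewrite cards1 | apply: cardR].
have -> : #|rotation_systems e| = #|family R|.
  by apply: eq_card => rho; rewrite rotation_systemsE.
have -> : #|[set rho in rotation_systems e | meets rho s]| = #|family R'|.
  apply: eq_card => rho; rewrite inE.
  apply/andP/familyP => [[rhoP] | rhoR'].
    rewrite (meets_agree sP rho0P rho0s rhoP) => /forall_inP agree v.
    move: rhoP; rewrite /R' rotation_systemsE => /forallP/(_ v).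
    by case: ifP => // vV _; rewrite inE agree.
  have rhoP : rho \in rotation_systems e.
    rewrite rotation_systemsE; apply/forallP => v.
    by have := rhoR' v; rewrite /R'; case: ifP => // _; rewrite inE => /eqP ->.
  split=> //; rewrite (meets_agree sP rho0P rho0s rhoP).
  by apply/forall_inP => v vV; have := rhoR' v; rewrite /R' vV inE.
have -> : (#|family R| = \prod_(v : T) 2)%N.
  rewrite card_family foldrE big_map big_enum /=.
  by apply: eq_bigr => v _; exact: cardR.
have -> : (#|family R'| = \prod_(v : T | v \notin V) 2)%N.
  rewrite card_family foldrE big_map big_enum [RHS]big_mkcond /=.
  by apply: eq_bigr => v _; rewrite cardR'; case: (v \in V).
by rewrite [RHS](bigID (mem V)) /= prod_nat_const mulnC.
Qed.

Lemma mean_meets s : circuit_seq e s ->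
  (\sum_(rho in rotation_systems e) (meets rho s)%:R) / #|rotation_systems e|%:R
    = (seq_chi e s)%:R * 2 ^- seq_r s :> rat.
Proof.
move=> sP.
rewrite -natr_sum -big_mkcondr sum1dep_card.
case: (boolP (seq_chi e s)) =>
    [/exists_inP[rho0 rho0P rho0s] | /exists_inP no_rho].
  rewrite -(card_meets sP rho0P rho0s) natrM natrX mul1r invfM mulrA.
  rewrite divff ?mul1r //.
  rewrite pnatr_eq0 -lt0n; apply/card_gt0P; exists rho0.
  by rewrite inE rho0P.
rewrite eq_card0 ?mul0r // => rho; rewrite !inE; apply/negP => /andP[rhoP rhos].
by case: no_rho; exists rho; rewrite ?inE.
Qed.

Lemma mean_num_faces_ge t :
  rot_expect e (fun rho => (num_faces_ge e t rho)%:R) =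
    \sum_(C in circuits e | (t <= circuit_len C)%N)
      (chi e C)%:R * 2 ^- circuit_r C.
Proof.
rewrite /rot_expect.
have -> : \sum_(rho in rotation_systems e) (num_faces_ge e t rho)%:R =
    \sum_(rho in rotation_systems e)
      \sum_(C in circuits e | (t <= circuit_len C)%N)
        (meets rho (circuit_repr C))%:R :> rat.
  apply: eq_bigr => rho rhoP; rewrite num_faces_ge_circuits // -natr_sum.
  rewrite -big_mkcondr sum1dep_card; congr _%:R.
  by apply: eq_card => C; rewrite !inE andbA.
rewrite exchange_big mulr_suml /=; apply: eq_bigr => C /andP[CP _].
have [s [sP _ Cs]] := circuits_repr CP.
by rewrite /chi /circuit_r Cs mean_meets.
Qed.

End Faces.

Theorem theorem12p2 (T : finType) (e : rel T) (l : nat) :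
  simple_graph e -> connected_graph e -> cubic e -> has_girth e l ->
  rot_expect e (fun rho => (num_faces e rho)%:R) =
    \sum_(C in circuits e) (chi e C)%:R * 2 ^- circuit_r C
  /\
  long_face_contribution e l =
    \sum_(C in circuits e | (2 * l <= circuit_len C)%N)
      (chi e C)%:R * 2 ^- circuit_r C.
Proof.
move=> [e_sym _] _ e_cubic _; split; last exact: mean_num_faces_ge.
have -> : rot_expect e (fun rho => (num_faces e rho)%:R) =
    rot_expect e (fun rho => (num_faces_ge e 0 rho)%:R).
  congr (_ / _); apply: eq_bigr => rho _; congr _%:R.
  by apply: eq_card => F; rewrite inE andbT.
by rewrite mean_num_faces_ge //; apply: eq_bigl => C; rewrite andbT.
Qed.
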